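(* Let $R$ be a Lie conformal algebra. Then: (1) $CDer_{(1,1,1)}R=CDer(R)$. (2) $CDer_{(0,1,-1)}R=QC(R)$. (3) $CDer_{(1,0,0)}R\cap CDer_{(0,1,0)}R=ZDer(R)$. (4) For all $\alpha,\beta,\gamma\in\mathbb{C}$ and all $\triangle\in\mathbb{C}\setminus\{0\}$, $CDer_{(\alpha,\beta,\gamma)}R=CDer_{(\triangle\alpha,\triangle\beta,\triangle\gamma)}R$.
   Context: Let $\mathcal{A}=\mathbb{C}[\partial]$. A Lie conformal algebra is an $\mathcal{A}$-module $R$ with a $\mathbb{C}$-bilinear map $R\otimes R\to R[\lambda]$, $a\otimes b\mapsto[a_\lambda b]$, such that for all $a,b,c\in R$: $[\partial a_\lambda b]=-\lambda[a_\lambda b]$, $[a_\lambda\partial b]=(\partial+\lambda)[a_\lambda b]$; $[a_\lambda b]=-[b_{-\lambda-\partial}a]$; $[a_\lambda[b_\mu c]]=[[a_\lambda b]_{\lambda+\mu}c]+[b_\mu[a_\lambda c]]$. $Cend\,R$ is the set of conformal linear maps from $R$ to $R$, i.e. $\mathbb{C}$-linear maps $D_\lambda:R\to R[\lambda]$ with $D_\lambda(\partial a)=(\partial+\lambda)D_\lambda(a)$ for all $a\in R$. Brackets such as $[(D_\lambda a)_{\lambda+\mu}b]$ are extended linearly over polynomials in the indeterminates. For $\alpha,\beta,\gamma\in\mathbb{C}$, the set of conformal $(\alpha,\beta,\gamma)$-derivations is $CDer_{(\alpha,\beta,\gamma)}R=\{D_\lambda\in Cend\,R\mid\alpha D_\lambda([a_\mu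 b])=[(\beta D_\lambda a)_{\lambda+\mu}b]+[a_\mu(\gamma D_\lambda b)]\ \forall a,b\in R\}$. $CDer(R)$ (conformal derivations): $D_\lambda\in Cend\,R$ with $D_\lambda([a_\mu b])=[(D_\lambda a)_{\lambda+\mu}b]+[a_\mu(D_\lambda b)]$ for all $a,b\in R$. $QC(R)$ (conformal quasicentroids): $D_\lambda\in Cend\,R$ with $[(D_\lambda a)_{\lambda+\mu}b]=[a_\mu(D_\lambda b)]$ for all $a,b\in R$. $ZDer(R)$: $D_\lambda\in Cend\,R$ with $[(D_\lambda a)_\mu b]=D_\lambda([a_\mu b])=0$ for all $a,b\in R$. *)

(* Defs.v *)
From HB Require Import structures.
From mathcomp Require Import all_boot all_order all_algebra.
From mathcomp Require Import classical_sets reals complex.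
From mathcomp Require Import finmap monalg.

Set Implicit Arguments.
Unset Strict Implicit.
Unset Printing Implicit Defensive.

Import GRing.Theory.

Local Open Scope ring_scope.
Local Open Scope classical_set_scope.

(* [vpoly V] is V[x], the polynomials in one indeterminate with coefficients  *)
(* in V, as finitely supported coefficient families; [vcoef f n] is the        *)
(* coefficient of x^n.  If V is a module over K then V[x] is a module over    *)
(* K[x], and [vpoly (vpoly V)] is V[x, y], a module over K[x][y].             *)
Definition vpoly (V : zmodType) : Type := {malg V[nat]}.

HB.instance Definition _ (V : zmodType) :=
  GRing.Zmodule.copy (vpoly V) {malg V[nat]}.

Definition vcoef (V : zmodType) (f : vpoly V) (n : nat) : V := mcoeff n f.

Definition vsupp (V : zmodType) (f : vpoly V) : seq nat := msupp f.

Definition vconst (V : zmodType) (v : V) : vpoly V := mkmalgU 0%N v.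

Section VpolyTheory.
Variable V : zmodType.
Implicit Types f g : vpoly V.

Lemma vpolyP f g : (forall n, vcoef f n = vcoef g n) <-> f = g.
Proof. exact: malgP. Qed.

Lemma vcoef0 n : vcoef (0 : vpoly V) n = 0. Proof. exact: mcoeff0. Qed.

Lemma vcoefD f g n : vcoef (f + g) n = vcoef f n + vcoef g n.
Proof. exact: mcoeffD. Qed.

Lemma vcoefN f n : vcoef (- f) n = - vcoef f n.
Proof. exact: mcoeffN. Qed.

Lemma vcoefC (v : V) n : vcoef (vconst v) n = v *+ (n == 0%N).
Proof. by rewrite /vcoef /vconst mcoeffU eq_sym. Qed.

Lemma vsuppP f n : (n \in vsupp f) = (vcoef f n != 0).
Proof. by rewrite mcoeff_neq0. Qed.

Lemma vsupp_uniq f : uniq (vsupp f).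
Proof. exact: fset_uniq. Qed.

End VpolyTheory.

Section VpolyModule.
Variables (K : nzRingType) (V : lmodType K).
Implicit Types (p q : {poly K}) (f g : vpoly V).

Definition vscale p f : vpoly V :=
  \sum_(i < size p) \sum_(n <- vsupp f) mkmalgU (i + n)%N (p`_i *: vcoef f n).

Lemma vcoef_vscale p f k :
  vcoef (vscale p f) k = \sum_(i < k.+1) p`_i *: vcoef f (k - i)%N.
Proof.
have inner (i : nat) :
    mcoeff k (\sum_(n <- vsupp f) mkmalgU (i + n)%N (p`_i *: vcoef f n)) =
    (p`_i *: vcoef f (k - i)%N) *+ (i <= k)%N.
  rewrite raddf_sum /=; under eq_bigr do rewrite mcoeffU.
  case: leqP => [le_ik|lt_ki]; last first.
    by apply: big1 => n _; rewrite gtn_eqF ?mulr0n // ltn_addr.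
  under eq_bigr => n _ do
    rewrite -{1}(subnKC le_ik) eqn_add2l.
  rewrite mulr1n.
  have [in_f|notin_f] := boolP ((k - i)%N \in vsupp f).
    rewrite (bigD1_seq _ in_f (vsupp_uniq f)) /= eqxx mulr1n big1 ?addr0 // => n.
    by move/negPf->.
  have /eqP -> : vcoef f (k - i)%N == 0 by rewrite -[_ == _]negbK -vsuppP.
  rewrite scaler0 big_seq big1 // => n n_f; case: eqP => // n_eq.
  by move: n_f; rewrite n_eq (negPf notin_f).
rewrite /vscale /vcoef raddf_sum /=.
under eq_bigr do rewrite inner.
rewrite -(big_mkord xpredT
  (fun i => (p`_i *: vcoef f (k - i)%N) *+ (i <= k)%N)).
rewrite -(big_mkord xpredT (fun i => p`_i *: vcoef f (k - i)%N)).
pose F i := (p`_i *: vcoef f (k - i)%N) *+ (i <= k)%N.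
have ext (n m : nat) : (n <= m)%N ->
    (forall i, (n <= i)%N -> F i = 0) ->
    \sum_(0 <= i < m) F i = \sum_(0 <= i < n) F i.
  move=> le_nm F0; rewrite (@big_cat_nat _ _ _ n) //= [X in _ + X]big_nat_cond.
  by rewrite [X in _ + X]big1 ?addr0 // => i /andP[/andP[/F0]].
transitivity (\sum_(0 <= i < maxn (size p) k.+1) F i).
  apply/esym/ext; first exact: leq_maxl.
  by move=> i le_pi; rewrite /F nth_default // scale0r mul0rn.
rewrite (ext k.+1) ?leq_maxr //; last by move=> i lt_ki; rewrite /F leqNgt lt_ki.
by apply: eq_big_nat => i /andP[_]; rewrite ltnS /F => ->.
Qed.

Lemma vscaleA p q f : vscale p (vscale q f) = vscale (p * q) f.
Proof.
apply/vpolyP => k; rewrite !vcoef_vscale.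
have -> : \sum_(i < k.+1) p`_i *: vcoef (vscale q f) (k - i)%N =
  \sum_(i < k.+1) \sum_(j < k.+1 | (i <= j)%N)
     (p`_i * q`_(j - i)) *: vcoef f (k - j)%N.
  apply: eq_bigr => i _; rewrite vcoef_vscale scaler_sumr.
  rewrite -(big_mkord (fun j => (i <= j)%N)
    (fun j => (p`_i * q`_(j - i)) *: vcoef f (k - j)%N)).
  have le_ik : (i <= k)%N by rewrite -ltnS.
  rewrite (@big_cat_nat _ _ _ i) //=; last exact: ltnW.
  rewrite [X in _ = X + _]big_nat_cond [X in _ = X + _]big1 ?add0r; last first.
    by move=> j /andP[/andP[_ lt_ji]]; rewrite leqNgt lt_ji.
  rewrite -[X in index_iota X _]add0n big_addn subSn // big_mkord.
  by apply: eq_big => [j|j _]; rewrite ?leq_addl // addnK scalerA [(j + i)%N]addnC subnDA.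
rewrite (exchange_big_dep xpredT) //=; apply: eq_bigr => j _.
rewrite coefM scaler_suml.
rewrite -(big_mkord (fun i => (i <= j)%N)
  (fun i => (p`_i * q`_(j - i)) *: vcoef f (k - j)%N)).
rewrite (@big_cat_nat _ _ _ j.+1) //= [X in _ + X]big_nat_cond.
rewrite [X in _ + X]big1 ?addr0; last first.
  by move=> i /andP[/andP[lt_ji _]]; rewrite leqNgt lt_ji.
rewrite big_nat_cond -(big_mkord xpredT
  (fun i => (p`_i * q`_(j - i)) *: vcoef f (k - j)%N)) [RHS]big_nat_cond.
by apply: eq_bigl => i; rewrite ltnS andbT; case: (i <= j)%N; rewrite ?andbF.
Qed.

Lemma vscale1 f : vscale 1 f = f.
Proof.
apply/vpolyP => k; rewrite vcoef_vscale big_ord_recl coef1 scale1r subn0.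
by rewrite big1 ?addr0 // => i _; rewrite coef1 scale0r.
Qed.

Lemma vscaleDr p f g : vscale p (f + g) = vscale p f + vscale p g.
Proof.
apply/vpolyP => k; rewrite vcoefD !vcoef_vscale -big_split /=.
by apply: eq_bigr => i _; rewrite vcoefD scalerDr.
Qed.

Lemma vscaleDl f p q : vscale (p + q) f = vscale p f + vscale q f.
Proof.
apply/vpolyP => k; rewrite vcoefD !vcoef_vscale -big_split /=.
by apply: eq_bigr => i _; rewrite coefD scalerDl.
Qed.

HB.instance Definition _ := GRing.Zmodule_isLmodule.Build {poly K} (vpoly V)
  vscaleA vscale1 vscaleDr vscaleDl.

Lemma vcoefZ p f k :
  vcoef (p *: f) k = \sum_(i < k.+1) p`_i *: vcoef f (k - i)%N.
Proof. exact: vcoef_vscale. Qed.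

End VpolyModule.

(* The value sum_n s^n g(v_n) of f = sum_n v_n x^n: coefficients are mapped   *)
(* by g into a module W where the indeterminate x acts as the scalar s.       *)
Definition vhorner (K : nzRingType) (V : zmodType) (W : lmodType K)
    (g : V -> W) (s : K) (f : vpoly V) : W :=
  \sum_(n <- vsupp f) s ^+ n *: g (vcoef f n).

(* R[lambda] is a module over C[d][lambda]; R[lambda, mu] is                  *)
(* [vpoly (vpoly R)], a module over C[d][lambda][mu].  Subscripts 0, 1, 2     *)
(* give the number of indeterminates of the module a scalar acts on;         *)
(* a constant c : C acts as [c%:P], [c%:P%:P], [c%:P%:P%:P] respectively.     *)
Notation d0 C := ('X : {poly C}).
Notation d1 C := ('X%:P : {poly {poly C}}).
Notation lambda1 C := ('X : {poly {poly C}}).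
Notation lambda2 C := ('X%:P : {poly {poly {poly C}}}).
Notation mu2 C := ('X : {poly {poly {poly C}}}).

(* The element f(s) of R[lambda, mu] obtained from f in R[x] by x := s. *)
Definition vsubst2 (C : nzRingType) (R : lmodType {poly C})
    (s : {poly {poly {poly C}}}) (f : vpoly R) : vpoly (vpoly R) :=
  vhorner (fun v => vconst (vconst v)) s f.

(* [lbr a b] is [a_lambda b].  In the Jacobi identity the outer [vhorner]     *)
(* extends the outer bracket linearly over the powers of the indeterminate of *)
(* the inner one, e.g. [a_lambda [b_mu c]] = sum_n mu^n [a_lambda c_n] for    *)
(* [b_mu c] = sum_n mu^n c_n.                                                 *)
HB.mixin Record isLieConformal (C : fieldType) R
    of GRing.Lmodule {poly C} R := {
  lbr : R -> R -> vpoly R;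
  lbr_linearl : forall (c : C) (a a' b : R),
    lbr (c%:P *: a + a') b = c%:P%:P *: lbr a b + lbr a' b;
  lbr_linearr : forall (c : C) (a b b' : R),
    lbr a (c%:P *: b + b') = c%:P%:P *: lbr a b + lbr a b';
  lbr_dl : forall a b : R,
    lbr (d0 C *: a) b = - (lambda1 C *: lbr a b);
  lbr_dr : forall a b : R,
    lbr a (d0 C *: b) = (d1 C + lambda1 C) *: lbr a b;
  lbr_skew : forall a b : R,
    lbr a b = - vhorner (@vconst R) (- lambda1 C - d1 C) (lbr b a);
  lbr_jacobi : forall a b c : R,
    vhorner (fun x => vsubst2 (lambda2 C) (lbr a x)) (mu2 C) (lbr b c) =
    vhorner (fun x => vsubst2 (lambda2 C + mu2 C) (lbr x c)) (lambda2 C)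
      (lbr a b) +
    vhorner (fun x => vsubst2 (mu2 C) (lbr b x)) (lambda2 C) (lbr a c)
}.

#[short(type="lieConformalType")]
HB.structure Definition LieConformal (C : fieldType) :=
  { R of GRing.Lmodule {poly C} R & isLieConformal C R }.

Section Derivations.
Variables (C : fieldType) (R : lieConformalType C).
Implicit Types (D : R -> vpoly R) (a b : R).

Definition Cend : set (R -> vpoly R) := [set D |
  (forall (c : C) a b, D (c%:P *: a + b) = c%:P%:P *: D a + D b) /\
  (forall a, D (d0 C *: a) = (d1 C + lambda1 C) *: D a)].

(* [a_s b] in R[lambda, mu] *)
Definition lbr_at (s : {poly {poly {poly C}}}) a b : vpoly (vpoly R) :=
  vsubst2 s (lbr a b).

(* [f_s b] for f in R[lambda] *)
Definition lbr_pl (s : {poly {poly {poly C}}}) (f : vpoly R) b :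
    vpoly (vpoly R) :=
  vhorner (fun x => lbr_at s x b) (lambda2 C) f.

(* [a_s f] for f in R[lambda] *)
Definition lbr_pr (s : {poly {poly {poly C}}}) a (f : vpoly R) :
    vpoly (vpoly R) :=
  vhorner (fun x => lbr_at s a x) (lambda2 C) f.

(* D_lambda([a_mu b]) *)
Definition cend_lbr D a b : vpoly (vpoly R) :=
  vhorner (fun x => vsubst2 (lambda2 C) (D x)) (mu2 C) (lbr a b).

Definition CDer_abc (alpha beta gamma : C) : set (R -> vpoly R) := [set D |
  Cend D /\ forall a b,
    alpha%:P%:P%:P *: cend_lbr D a b =
    lbr_pl (lambda2 C + mu2 C) (beta%:P%:P *: D a) b +
    lbr_pr (mu2 C) a (gamma%:P%:P *: D b)].

Definition CDer : set (R -> vpoly R) := [set D |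
  Cend D /\ forall a b,
    cend_lbr D a b =
    lbr_pl (lambda2 C + mu2 C) (D a) b + lbr_pr (mu2 C) a (D b)].

Definition QC : set (R -> vpoly R) := [set D |
  Cend D /\ forall a b,
    lbr_pl (lambda2 C + mu2 C) (D a) b = lbr_pr (mu2 C) a (D b)].

Definition ZDer : set (R -> vpoly R) := [set D |
  Cend D /\ forall a b,
    lbr_pl (mu2 C) (D a) b = 0 /\ cend_lbr D a b = 0].

End Derivations.

Arguments Cend {C} R.
Arguments CDer_abc {C} R alpha beta gamma.
Arguments CDer {C} R.
Arguments QC {C} R.
Arguments ZDer {C} R.

(* Main.v *)
Require Import Defs.
From HB Require Import structures.
From mathcomp Require Import all_boot all_order all_algebra.
From mathcomp Require Import classical_sets reals complex.

Set Implicit Arguments.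
Unset Strict Implicit.
Unset Printing Implicit Defensive.

Import GRing.Theory.

Local Open Scope ring_scope.
Local Open Scope classical_set_scope.

(** The defining identity of a conformal [(alpha, beta, gamma)]-derivation is
    homogeneous of degree one in [(alpha, beta, gamma)]: extending a bracket
    over the powers of an indeterminate preserves linearity over the constants
    ([lbr_plZ], [lbr_prZ]), so scalars can be pulled out of both terms on the
    right.  Rescaling by a nonzero [delta] is then invertible, and the triples
    [(1, 1, 1)] and [(0, 1, -1)] give derivations and quasicentroids by
    specialization.

    The case of [ZDer] needs one more idea.  The triple [(0, 1, 0)] says that
    [[(D_lambda a)_(lambda + mu) b]] vanishes, while [ZDer] asks this of
    [[(D_lambda a)_mu b]].  Each of the two polynomials is obtained from the
    other by an invertible change of variables, [mu := mu - lambda] or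
    [mu := lambda + mu].  Such a change of variables is itself an instance of
    [vhorner], namely [vhorner vconst t]; it is semilinear along
    [p |-> p \Po t] ([vhorner_vconstZ]), so it acts on brackets by acting on
    their subscript ([vhorner_lbr_pl]). *)

(** * Coefficients of products by constants and by the indeterminate *)

Lemma vcoefZC (K : nzRingType) (V : lmodType K) (c : K) (f : vpoly V) k :
  vcoef (c%:P *: f) k = c *: vcoef f k.
Proof.
rewrite vcoefZ big_ord_recl /= coefC eqxx subn0 big1 ?addr0 // => i _.
by rewrite coefC scale0r.
Qed.

Lemma vcoefZX (K : nzRingType) (V : lmodType K) (f : vpoly V) k :
  vcoef ('X *: f) k = if k is k'.+1 then vcoef f k' else 0.
Proof.
rewrite vcoefZ big_ord_recl coefX scale0r add0r.
case: k => [|k]; first by rewrite big_ord0.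
rewrite big_ord_recl coefX scale1r subSS subn0 big1 ?addr0 // => i _.
by rewrite coefX scale0r.
Qed.

Lemma vconstD (V : zmodType) : {morph @vconst V : u v / u + v}.
Proof.
by move=> u v; apply/vpolyP => n; rewrite vcoefD !vcoefC mulrnDl.
Qed.

Lemma vconstZ (K : nzRingType) (V : lmodType K) (c : K) (v : V) :
  vconst (c *: v) = c%:P *: vconst v.
Proof. by apply/vpolyP => n; rewrite vcoefZC !vcoefC scalerMnr. Qed.

(** * Evaluation of polynomials with coefficients in a module *)

Lemma morphD0 (V W : zmodType) (g : V -> W) :
  {morph g : u v / u + v} -> g 0 = 0.
Proof. by move=> gD; apply: (addrI (g 0)); rewrite -gD !addr0. Qed.

Lemma vcoef_bounded (V : zmodType) (f : vpoly V) :
  exists N, forall n, (N <= n)%N -> vcoef f n = 0.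
Proof.
exists (\max_(m <- vsupp f) m).+1 => n; rewrite ltnNge => /negP lt_max.
apply/eqP; rewrite -[_ == 0]negbK -vsuppP; apply/negP => n_f.
by apply: lt_max; exact: (@leq_bigmax_seq _ _ xpredT id).
Qed.

(** The supports of a sum or of a multiple may shrink by cancellation, so
    identities between values of [vhorner] are proved on a common range of
    exponents. *)
Lemma vhornerE (K : nzRingType) (V : zmodType) (W : lmodType K)
    (g : V -> W) (s : K) (f : vpoly V) N :
    g 0 = 0 -> (forall n, (N <= n)%N -> vcoef f n = 0) ->
  vhorner g s f = \sum_(n < N) s ^+ n *: g (vcoef f n).
Proof.
move=> g0 fN; rewrite /vhorner.
rewrite -(big_mkord xpredT (fun n => s ^+ n *: g (vcoef f n))).
rewrite [RHS](bigID (mem (vsupp f))) /= [X in _ = _ + X]big1 ?addr0; last first.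
  by move=> n; rewrite vsuppP negbK => /eqP ->; rewrite g0 scaler0.
rewrite -[RHS]big_filter; apply/perm_big/uniq_perm.
- exact: vsupp_uniq.
- by rewrite filter_uniq // iota_uniq.
move=> n; rewrite mem_filter mem_index_iota /=.
have [|] := boolP (n \in vsupp f); rewrite //= vsuppP ltnNge => fn.
by apply/esym/negP => /fN fn0; rewrite fn0 eqxx in fn.
Qed.

Lemma vhornerD (K : nzRingType) (V : zmodType) (W : lmodType K)
    (g : V -> W) (s : K) :
  {morph g : u v / u + v} -> {morph vhorner g s : f h / f + h}.
Proof.
move=> gD f h; have g0 := morphD0 gD.
have [N1 fN] := vcoef_bounded f; have [N2 hN] := vcoef_bounded h.
have fM n : (maxn N1 N2 <= n)%N -> vcoef f n = 0.
  by rewrite geq_max => /andP[/fN].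
have hM n : (maxn N1 N2 <= n)%N -> vcoef h n = 0.
  by rewrite geq_max => /andP[_ /hN].
rewrite (vhornerE s g0 fM) (vhornerE s g0 hM).
rewrite (@vhornerE _ _ _ _ _ _ (maxn N1 N2) g0); last first.
  by move=> n le_n; rewrite vcoefD fM // hM // addr0.
by rewrite -big_split; apply: eq_bigr => n _; rewrite vcoefD gD scalerDr.
Qed.

(** The coefficient ring may act differently on the source and the target of
    [g], whence the two scalars [c] and [c']. *)
Lemma vhornerZC (K : nzRingType) (L : comNzRingType) (V : lmodType K)
    (W : lmodType L) (g : V -> W) (s : L) (c : K) (c' : L) (f : vpoly V) :
    g 0 = 0 -> (forall v, g (c *: v) = c' *: g v) ->
  vhorner g s (c%:P *: f) = c' *: vhorner g s f.
Proof.
move=> g0 gZ; have [N fN] := vcoef_bounded f.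
rewrite (vhornerE s g0 fN) (@vhornerE _ _ _ _ _ _ N g0); last first.
  by move=> n le_n; rewrite vcoefZC fN // scaler0.
rewrite scaler_sumr; apply: eq_bigr => n _.
by rewrite vcoefZC gZ !scalerA mulrC.
Qed.

Lemma vhornerZX (K L : nzRingType) (V : lmodType K)
    (W : lmodType L) (g : V -> W) (s : L) (f : vpoly V) :
  g 0 = 0 -> vhorner g s ('X *: f) = s *: vhorner g s f.
Proof.
move=> g0; have [N fN] := vcoef_bounded f.
rewrite (vhornerE s g0 fN) (@vhornerE _ _ _ _ _ _ N.+1 g0); last first.
  by case=> // n le_n; rewrite vcoefZX fN.
rewrite big_ord_recl vcoefZX g0 scaler0 add0r scaler_sumr.
by apply: eq_bigr => n _; rewrite vcoefZX scalerA -exprS.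
Qed.

Lemma vhorner_vconst (K : nzRingType) (V : zmodType) (W : lmodType K)
    (g : V -> W) (s : K) (v : V) :
  g 0 = 0 -> vhorner g s (vconst v) = g v.
Proof.
move=> g0; rewrite (@vhornerE _ _ _ _ _ _ 1 g0); last first.
  by case=> // n _; rewrite vcoefC.
by rewrite big_ord1 vcoefC scale1r.
Qed.

(** * Changes of variables *)

(** Substitution of [t] acts on scalars and vectors alike, so for a [t] that
    has a compositional inverse it is an honest change of variables.  Constants
    and the indeterminate generate the scalars, so those two cases suffice. *)
Lemma vhorner_vconstZ (K : comNzRingType) (V : lmodType K) (t p : {poly K})
    (f : vpoly V) :
  vhorner (@vconst V) t (p *: f) = (p \Po t) *: vhorner (@vconst V) t f.
Proof.
have cD := @vconstD V; have c0 := morphD0 cD.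
elim/poly_ind: p f => [|p c IHp] f.
  by rewrite comp_poly0 !scale0r (morphD0 (vhornerD t cD)).
rewrite scalerDl (vhornerD t cD) -scalerA IHp vhornerZX //.
rewrite (@vhornerZC _ _ _ _ _ t c c%:P _ c0 (@vconstZ K V c)).
by rewrite comp_poly_MXaddC scalerDl scalerA.
Qed.

Lemma comp_polyDX (K : comNzRingType) (c : K) :
  (c%:P + 'X) \Po ('X - c%:P) = 'X.
Proof. by rewrite comp_polyD comp_polyC comp_polyX addrC subrK. Qed.

Lemma vsubst2D (C : nzRingType) (R : lmodType {poly C}) s :
  {morph @vsubst2 C R s : f h / f + h}.
Proof. by apply: vhornerD => u v; rewrite !vconstD. Qed.

Lemma vsubst2Z (C : comNzRingType) (R : lmodType {poly C}) s (c : C)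
    (f : vpoly R) :
  vsubst2 s (c%:P%:P *: f) = c%:P%:P%:P *: vsubst2 s f.
Proof.
apply: vhornerZC => [|v]; last by rewrite !vconstZ.
by rewrite !(morphD0 (@vconstD _)).
Qed.

(** * Brackets with polynomial arguments *)

Lemma lbr_atDl (C : fieldType) (R : lieConformalType C) s (b : R) :
  {morph (fun x => lbr_at s x b) : u v / u + v}.
Proof.
move=> u v; rewrite /lbr_at -{1}[u]scale1r -polyC1 lbr_linearl.
by rewrite !polyC1 scale1r vsubst2D.
Qed.

Lemma lbr_atDr (C : fieldType) (R : lieConformalType C) s (a : R) :
  {morph lbr_at s a : u v / u + v}.
Proof.
move=> u v; rewrite /lbr_at -{1}[u]scale1r -polyC1 lbr_linearr.
by rewrite !polyC1 scale1r vsubst2D.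
Qed.

(** Linearity of the bracket is given for [c%:P *: u + v] only, so the value at
    [v := 0] has to be cancelled. *)
Lemma lbr_atZl (C : fieldType) (R : lieConformalType C) s (c : C) (a b : R) :
  lbr_at s (c%:P *: a) b = c%:P%:P%:P *: lbr_at s a b.
Proof.
rewrite -[c%:P *: a]addr0 /lbr_at lbr_linearl vsubst2D vsubst2Z.
by rewrite [X in _ + X](morphD0 (lbr_atDl s b)) addr0.
Qed.

Lemma lbr_atZr (C : fieldType) (R : lieConformalType C) s (c : C) (a b : R) :
  lbr_at s a (c%:P *: b) = c%:P%:P%:P *: lbr_at s a b.
Proof.
rewrite -[c%:P *: b]addr0 /lbr_at lbr_linearr vsubst2D vsubst2Z.
by rewrite [X in _ + X](morphD0 (lbr_atDr s a)) addr0.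
Qed.

Lemma lbr_plZ (C : fieldType) (R : lieConformalType C) s (c : C)
    (f : vpoly R) (b : R) :
  lbr_pl s (c%:P%:P *: f) b = c%:P%:P%:P *: lbr_pl s f b.
Proof.
apply: vhornerZC => [|v]; last exact: lbr_atZl.
exact: morphD0 (lbr_atDl s b).
Qed.

Lemma lbr_prZ (C : fieldType) (R : lieConformalType C) s (c : C) (a : R)
    (f : vpoly R) :
  lbr_pr s a (c%:P%:P *: f) = c%:P%:P%:P *: lbr_pr s a f.
Proof.
apply: vhornerZC => [|v]; last exact: lbr_atZr.
exact: morphD0 (lbr_atDr s a).
Qed.

Lemma vhorner_vsubst2 (C : comNzRingType) (R : lmodType {poly C})
    (s t : {poly {poly {poly C}}}) (f : vpoly R) :
  vhorner (@vconst (vpoly R)) t (vsubst2 s f) = vsubst2 (s \Po t) f.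
Proof.
have cD := @vconstD (vpoly R); have c0 := morphD0 cD.
rewrite /vsubst2 {2 3}/vhorner.
rewrite (big_morph _ (vhornerD t cD) (morphD0 (vhornerD t cD))).
apply: eq_bigr => n _.
by rewrite vhorner_vconstZ (rmorphXn (comp_poly t)) vhorner_vconst.
Qed.

(** The powers of [lambda] that carry the first argument are constants for the
    outer indeterminate [mu], so substituting for [mu] only affects the
    subscript. *)
Lemma vhorner_lbr_pl (C : fieldType) (R : lieConformalType C)
    (s t : {poly {poly {poly C}}}) (f : vpoly R) (b : R) :
  vhorner (@vconst (vpoly R)) t (lbr_pl s f b) = lbr_pl (s \Po t) f b.
Proof.
have cD := @vconstD (vpoly R).
rewrite /lbr_pl {2 3}/vhorner.
rewrite (big_morph _ (vhornerD t cD) (morphD0 (vhornerD t cD))).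
apply: eq_bigr => n _; rewrite vhorner_vconstZ /lbr_at vhorner_vsubst2.
by rewrite -(rmorphXn (@polyC _)) comp_polyC.
Qed.

(** The shift of [mu] by [lambda] carries the subscript [mu] to [lambda + mu],
    and the opposite shift carries it back. *)
Lemma lbr_pl_shift_eq0 (C : fieldType) (R : lieConformalType C)
    (f : vpoly R) (b : R) :
  lbr_pl (lambda2 C + mu2 C) f b = 0 <-> lbr_pl (mu2 C) f b = 0.
Proof.
have sub0 t : vhorner (@vconst (vpoly R)) t 0 = 0.
  exact: morphD0 (vhornerD t (@vconstD _)).
split=> [f0|f0].
- by rewrite -(comp_polyDX 'X) -vhorner_lbr_pl f0 sub0.
- by rewrite -[X in lbr_pl X](comp_polyX (lambda2 C + mu2 C)) -vhorner_lbr_pl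
    f0 sub0.
Qed.

(** * Conformal generalized derivations *)

(** The scalars of the identity are described by their images [p], [q], [r] in
    the coefficient ring, so that the manipulations of the identity that follow
    can be carried out in an arbitrary module. *)
Lemma CDer_abcP (C : fieldType) (R : lieConformalType C)
    (alpha beta gamma : C) (p q r : {poly {poly {poly C}}})
    (D : R -> vpoly R) :
    alpha%:P%:P%:P = p -> beta%:P%:P%:P = q -> gamma%:P%:P%:P = r ->
  CDer_abc R alpha beta gamma D <-> Cend R D /\ forall a b,
    p *: cend_lbr D a b =
    q *: lbr_pl (lambda2 C + mu2 C) (D a) b + r *: lbr_pr (mu2 C) a (D b).
Proof.
move=> <- <- <-.
by split=> -[DC DE]; split=> // a b; have := DE a b; rewrite lbr_plZ lbr_prZ.
Qed.

Lemma polyCCCM (C : nzRingType) (c c' : C) :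
  (c * c')%:P%:P%:P = c%:P%:P%:P * c'%:P%:P%:P :> {poly {poly {poly C}}}.
Proof. by rewrite !polyCM. Qed.

Lemma polyCCC0 (C : nzRingType) :
  (0 : C)%:P%:P%:P = 0 :> {poly {poly {poly C}}}.
Proof. by rewrite !polyC0. Qed.

Lemma polyCCC1 (C : nzRingType) :
  (1 : C)%:P%:P%:P = 1 :> {poly {poly {poly C}}}.
Proof. by rewrite !polyC1. Qed.

Lemma polyCCCN1 (C : nzRingType) :
  (-1 : C)%:P%:P%:P = -1 :> {poly {poly {poly C}}}.
Proof. by rewrite !polyCN !polyC1. Qed.

Lemma scaler_eqD_unit (L : nzRingType) (W : lmodType L) (c c' p q r : L)
    (x y z : W) : c' * c = 1 ->
  p *: x = q *: y + r *: z <->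
  (c * p) *: x = (c * q) *: y + (c * r) *: z.
Proof.
move=> c'c; rewrite -!scalerA -scalerDr; split=> [-> //|].
by move/(congr1 ( *:%R c')); rewrite !(scalerA c' c) c'c !scale1r.
Qed.

Lemma scaler_eqD111 (L : nzRingType) (W : lmodType L) (x y z : W) :
  (1 : L) *: x = (1 : L) *: y + (1 : L) *: z <-> x = y + z.
Proof. by rewrite !scale1r. Qed.

Lemma scaler_eqD01N1 (L : nzRingType) (W : lmodType L) (x y z : W) :
  (0 : L) *: x = (1 : L) *: y + (-1 : L) *: z <-> y = z.
Proof.
rewrite scale0r scale1r scaleN1r; split=> [/esym/eqP|->].
  by rewrite subr_eq0 => /eqP.
by rewrite subrr.
Qed.

Lemma scaler_eqD100 (L : nzRingType) (W : lmodType L) (x y z : W) :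
  (1 : L) *: x = (0 : L) *: y + (0 : L) *: z <-> x = 0.
Proof. by rewrite !scale0r scale1r addr0. Qed.

Lemma scaler_eqD010 (L : nzRingType) (W : lmodType L) (x y z : W) :
  (0 : L) *: x = (1 : L) *: y + (0 : L) *: z <-> y = 0.
Proof. by rewrite !scale0r scale1r addr0; split=> ->. Qed.

Lemma CDer_abc_CDer (C : fieldType) (R : lieConformalType C) :
  CDer_abc R 1 1 1 = CDer R.
Proof.
have c1 := polyCCC1 C.
apply/seteqP; split=> D.
  case/(CDer_abcP D c1 c1 c1) => DC DE; split; first exact: DC.
  by move=> a b; exact: (proj1 (scaler_eqD111 _ _ _) (DE a b)).
move=> [DC DE]; apply: (proj2 (CDer_abcP D c1 c1 c1)).
split; first exact: DC.
by move=> a b; exact: (proj2 (scaler_eqD111 _ _ _) (DE a b)).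
Qed.

Lemma CDer_abc_QC (C : fieldType) (R : lieConformalType C) :
  CDer_abc R 0 1 (-1) = QC R.
Proof.
have [[c0 c1] cN1] := (polyCCC0 C, polyCCC1 C, polyCCCN1 C).
apply/seteqP; split=> D.
  case/(CDer_abcP D c0 c1 cN1) => DC DE; split; first exact: DC.
  by move=> a b; exact: (proj1 (scaler_eqD01N1 _ _ _) (DE a b)).
move=> [DC DE]; apply: (proj2 (CDer_abcP D c0 c1 cN1)).
split; first exact: DC.
by move=> a b; exact: (proj2 (scaler_eqD01N1 _ _ _) (DE a b)).
Qed.

Lemma CDer_abc_ZDer (C : fieldType) (R : lieConformalType C) :
  CDer_abc R 1 0 0 `&` CDer_abc R 0 1 0 = ZDer R.
Proof.
have [c0 c1] := (polyCCC0 C, polyCCC1 C).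
apply/seteqP; split=> D.
  case=> /(CDer_abcP D c1 c0 c0)[DC DE1] /(CDer_abcP D c0 c1 c0)[_ DE2].
  split; first exact: DC.
  move=> a b; split; last exact: (proj1 (scaler_eqD100 _ _ _) (DE1 a b)).
  apply: (proj1 (lbr_pl_shift_eq0 _ _)).
  exact: (proj1 (scaler_eqD010 _ _ _) (DE2 a b)).
move=> [DC DE]; split.
  apply: (proj2 (CDer_abcP D c1 c0 c0)); split; first exact: DC.
  by move=> a b; exact: (proj2 (scaler_eqD100 _ _ _) (proj2 (DE a b))).
apply: (proj2 (CDer_abcP D c0 c1 c0)); split; first exact: DC.
move=> a b; apply: (proj2 (scaler_eqD010 _ _ _)).
exact: (proj2 (lbr_pl_shift_eq0 _ _) (proj1 (DE a b))).
Qed.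

Lemma CDer_abc_scale (C : fieldType) (R : lieConformalType C)
    (alpha beta gamma delta : C) : delta != 0 ->
  CDer_abc R alpha beta gamma =
  CDer_abc R (delta * alpha) (delta * beta) (delta * gamma).
Proof.
move=> nz_delta.
have inv_delta : (delta^-1)%:P%:P%:P * delta%:P%:P%:P = 1
    :> {poly {poly {poly C}}}.
  by rewrite -polyCCCM (mulVf nz_delta) !polyC1.
have scaleP (D : R -> vpoly R) := CDer_abcP D (polyCCCM delta alpha)
  (polyCCCM delta beta) (polyCCCM delta gamma).
apply/seteqP; split=> D.
  case/(CDer_abcP D erefl erefl erefl) => DC DE.
  apply: (proj2 (scaleP D)); split; first exact: DC.
  by move=> a b; exact: (proj1 (scaler_eqD_unit _ _ _ _ _ _ inv_delta) (DE a b)).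
case/(scaleP D) => DC DE; apply: (proj2 (CDer_abcP D erefl erefl erefl)).
split; first exact: DC.
by move=> a b; exact: (proj2 (scaler_eqD_unit _ _ _ _ _ _ inv_delta) (DE a b)).
Qed.

Theorem proposition4p1 (K : realType) (R : lieConformalType K[i]) :
  [/\ CDer_abc R 1 1 1 = CDer R,
      CDer_abc R 0 1 (-1) = QC R,
      CDer_abc R 1 0 0 `&` CDer_abc R 0 1 0 = ZDer R
    & forall alpha beta gamma delta : K[i], delta != 0 ->
        CDer_abc R alpha beta gamma =
        CDer_abc R (delta * alpha) (delta * beta) (delta * gamma)].
Proof.
split.
- exact: CDer_abc_CDer.
- exact: CDer_abc_QC.
- exact: CDer_abc_ZDer.
- exact: CDer_abc_scale.
Qed.
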